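(* Let $E$ be a reflexive Banach space with the approximation property. Then the weak*-closed left ideals of $\mathcal{B}(E)$ are exactly the sets $$\mathscr{I}_{\mathcal{B}(E)}(F)=\{T\in\mathcal{B}(E):\ker T\supset F\},$$ as $F$ runs through the closed linear subspaces of $E$. The weak*-closed right ideals of $\mathcal{B}(E)$ are exactly the sets $$\mathscr{R}_{\mathcal{B}(E)}(F)=\{T\in\mathcal{B}(E):\operatorname{im}T\subset F\},$$ as $F$ runs through the closed linear subspaces of $E$.
   Context: $\mathcal{B}(E)$ is the algebra of bounded linear operators on $E$. For reflexive $E$, $\mathcal{B}(E)$ is the dual of the projective tensor product $E\widehat{\otimes}E'$ via $\langle x\otimes\lambda,T\rangle=\lambda(Tx)$, and the weak*-topology is the one induced by this predual. $E$ has the approximation property if for every compact $K\subset E$ and every $\varepsilon>0$ there is a bounded finite-rank operator $T$ on $E$ with $\|Tx-x\|<\varepsilon$ for all $x\in K$. *)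

(* Defs.v *)
From HB Require Import structures.
From mathcomp Require Import all_boot all_order all_algebra.
From mathcomp Require Import sesquilinear complex.
From mathcomp Require Import all_classical all_reals all_analysis.

Set Implicit Arguments.
Unset Strict Implicit.
Unset Printing Implicit Defensive.

Import Order.TTheory GRing.Theory Num.Theory.
Import numFieldNormedType.Exports.

Local Open Scope classical_set_scope.
Local Open Scope ring_scope.

(* Everything below makes sense over an arbitrary K : numFieldType, in which
   norms take their values, but is only meant for K = R and K = R[i] with
   R : realType. In R[i], x <= y means that y - x is a nonnegative real, so
   that suprema and infima of sets of norms are the usual real ones. *)

Section BoundedOperators.
Variables (K : numFieldType) (E F : normedModType K).

Definition bounded_linear : {pred E -> F} :=
  [pred f : E -> F |
    `[< linear f /\ exists M : K, forall x, `|f x| <= M * `|x| >]].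

Record bop := Bop { bop_fun :> E -> F; _ : bop_fun \in bounded_linear }.

HB.instance Definition _ := [isSub of bop for bop_fun].
HB.instance Definition _ := [Choice of bop by <:].

Lemma bounded_linear_submod_closed : submod_closed bounded_linear.
Proof.
split=> [|a f g /asboolP[lf [M fM]] /asboolP[lg [N gN]]]; apply/asboolP; split.
- by move=> b x y; rewrite /= scaler0 addr0.
- by exists 0 => x; rewrite mul0r normr0.
- move=> b x y; rewrite -[LHS]/(a *: f (b *: x + y) + g (b *: x + y)) lf lg.
  rewrite -[RHS]/(b *: (a *: f x + g x) + (a *: f y + g y)).
  by rewrite !scalerDr !scalerA (mulrC a b) addrACA.
- exists (`|a| * M + N) => x; rewrite -[X in `|X| <= _]/(a *: f x + g x).
  rewrite (le_trans (ler_normD _ _))// mulrDl lerD// normrZ -mulrA.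
  by rewrite ler_wpM2l.
Qed.

HB.instance Definition _ :=
  GRing.isSubmodClosed.Build K (E -> F) bounded_linear
    bounded_linear_submod_closed.
HB.instance Definition _ := [SubChoice_isSubLmodule of bop by <:].

Lemma bop_linear (T : bop) : linear T.
Proof. by case: T => f /= /asboolP[]. Qed.

Lemma bop_bounded (T : bop) : exists M : K, forall x, `|T x| <= M * `|x|.
Proof. by case: T => f /= /asboolP[]. Qed.

HB.instance Definition _ (T : bop) :=
  GRing.isLinear.Build K E F *:%R T (@bop_linear T).

Definition opnorm (T : bop) : K :=
  supremum 0 [set `|T x| | x in [set x : E | `|x| <= 1]].

End BoundedOperators.

Section BoundedEndomorphisms.
Variables (K : numFieldType) (E : normedModType K).
Implicit Types S T U : bop E E.

Lemma bop_id_subproof : (id : E -> E) \in @bounded_linear K E E.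
Proof. by apply/asboolP; split=> //; exists 1 => x; rewrite mul1r. Qed.

Definition bop_id : bop E E := Bop bop_id_subproof.

Lemma bop_comp_subproof S T : S \o T \in @bounded_linear K E E.
Proof.
apply/asboolP; have [M SM] := bop_bounded S; have [N TN] := bop_bounded T.
split=> /= [a x y|]; first by rewrite /comp !linearP.
exists (`|M| * N) => x; have := SM (T x) => STM; rewrite (le_trans STM)//.
have /ger0_norm <- : 0 <= M * `|T x| := le_trans (normr_ge0 _) STM.
by rewrite normrM normr_id -mulrA ler_wpM2l.
Qed.

Definition bop_comp S T : bop E E := Bop (bop_comp_subproof S T).

Lemma bop_compA : associative bop_comp.
Proof. by move=> S T U; exact/val_inj. Qed.

Lemma bop_comp1l : left_id bop_id bop_comp.
Proof. by move=> T; exact/val_inj. Qed.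

Lemma bop_comp1r : right_id bop_id bop_comp.
Proof. by move=> T; exact/val_inj. Qed.

Lemma bop_compDl : left_distributive bop_comp +%R.
Proof. by move=> S T U; exact/val_inj. Qed.

Lemma bop_compDr : right_distributive bop_comp +%R.
Proof.
by move=> S T U; apply/val_inj/funext => x; exact: (linearD S (T x) (U x)).
Qed.

HB.instance Definition _ := GRing.Zmodule_isPzRing.Build (bop E E)
  bop_compA bop_comp1l bop_comp1r bop_compDl bop_compDr.

End BoundedEndomorphisms.

Notation "''B' ( E )" := (bop E E) (at level 8, format "''B' ( E )").

Section BanachSpaceProperties.
Variables (K : numFieldType) (E : normedModType K).

Definition dual := bop E K^o.

(* The hypotheses on phi say that it is a bounded linear functional on the
   normed space dual, whose norm is opnorm. *)
Definition reflexive_space := forall phi : dual -> K^o,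
  linear phi ->
  (exists M : K, forall l : dual, `|phi l| <= M * opnorm l) ->
  exists x : E, forall l : dual, phi l = l x.

Definition finite_rank (T : 'B(E)) := exists (n : nat) (v : 'I_n -> E),
  forall x, exists c : 'I_n -> K, T x = \sum_(i < n) c i *: v i.

Definition approximation_property := forall (C : set E) (e : K),
  compact C -> 0 < e ->
  exists T : 'B(E), finite_rank T /\ forall x, C x -> `|T x - x| < e.

End BanachSpaceProperties.

HB.instance Definition _ (K : numFieldType) (E : normedModType K) :=
  GRing.Lmodule.copy (dual E) (bop E K^o).

Section ProjectiveTensorProduct.
Variables (K : numFieldType) (E : normedModType K).

(* The formal sum w stands for the sum of the elementary tensors p.1 (x) p.2,
   p in w, in the algebraic tensor product of E and dual E. *)
Definition formal_sum := seq (E * dual E).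

(* Two formal sums are equal in the algebraic tensor product when no bilinear
   map separates them. *)
Definition tensor_eq (w1 w2 : formal_sum) :=
  forall (V : lmodType K) (b : {bilinear E -> dual E -> V}),
    \sum_(p <- w1) b p.1 p.2 = \sum_(p <- w2) b p.1 p.2.

Definition tensor_sub (w1 w2 : formal_sum) : formal_sum :=
  w1 ++ [seq (- p.1, p.2) | p <- w2].

Definition projective_norm (w : formal_sum) : K :=
  infimum 0 [set \sum_(p <- v) `|p.1| * opnorm p.2
            | v in [set v | tensor_eq v w]].

Definition projective_cauchy (u : nat -> formal_sum) :=
  forall e : K, 0 < e -> exists N : nat, forall m n : nat,
    (N <= m)%N -> (N <= n)%N -> projective_norm (tensor_sub (u m) (u n)) < e.

(* The completion of the algebraic tensor product for the projective norm. Its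
   points are represented by Cauchy sequences and are not identified when they
   are at distance 0: the pairing with 'B(E) below takes the same value on
   such sequences, hence the topology it induces on 'B(E) is the same. *)
Record projective_tensor := ProjectiveTensor {
  projective_seq :> nat -> formal_sum;
  _ : projective_cauchy projective_seq
}.

HB.instance Definition _ := gen_eqMixin projective_tensor.
HB.instance Definition _ := gen_choiceMixin projective_tensor.

Definition pairing (u : projective_tensor) (T : 'B(E)) : K^o :=
  lim ((\sum_(p <- u n) p.2 (T p.1) : K^o) @[n --> \oo]).

(* 'B(E) with the coarsest topology that makes every T |-> pairing u T
   continuous. *)
Definition weakstar :=
  initial_topology (fun T : 'B(E) =>
    (pairing^~ T : {ptws projective_tensor -> K^o})).

HB.instance Definition _ := Topological.on weakstar.

Definition weakstar_closed (I : set 'B(E)) := closed (I : set weakstar).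

End ProjectiveTensorProduct.

Section Ideals.
Variables (K : numFieldType) (E : normedModType K).

Definition linear_subspace (V : lmodType K) (F : set V) :=
  F 0 /\ forall (a : K) (x y : V), F x -> F y -> F (a *: x + y).

Definition left_ideal (I : set 'B(E)) :=
  linear_subspace I /\ forall S T : 'B(E), I T -> I (S * T).

Definition right_ideal (I : set 'B(E)) :=
  linear_subspace I /\ forall S T : 'B(E), I T -> I (T * S).

Definition closed_subspace (F : set E) := linear_subspace F /\ closed F.

Definition ideal_ker (F : set E) : set 'B(E) :=
  [set T : 'B(E) | F `<=` [set x | T x = 0]].

Definition ideal_im (F : set E) : set 'B(E) :=
  [set T : 'B(E) | range T `<=` F].

End Ideals.

(* Main.v *)
(* A weak*-closed set of operators is closed for uniform convergence on compact
   sets: an element of the projective tensor product is a series of elementary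
   tensors x_k (x) l_k in which, after rescaling, x_k tends to 0 and the norms of
   the l_k are summable. By the approximation property T is then a limit of S T
   and of T S with S of finite rank, so an ideal I contains T as soon as it
   contains these products. A finite-rank operator U is a sum of rank-one
   operators U z (x) (l o U), so that only rank-one operators matter.

   For a right ideal I, the y such that I contains every y (x) l form a closed
   subspace F and I = R(F). For a left ideal I, let F be the intersection of the
   kernels of the elements of I. The l such that I contains every y (x) l form a
   closed subspace M of E' whose annihilator in E is F, and by reflexivity and the
   Hahn-Banach theorem M is the annihilator of F. *)
From HB Require Import structures.
Require Import Defs.
From mathcomp Require Import all_boot all_order all_algebra complex.
From mathcomp Require Import sesquilinear ring lra.
From mathcomp Require Import all_classical all_reals all_analysis.
Import Order.TTheory GRing.Theory Num.Theory.
Import numFieldNormedType.Exports.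
Set Implicit Arguments.
Unset Strict Implicit.
Unset Printing Implicit Defensive.
Local Open Scope classical_set_scope.
Local Open Scope ring_scope.

(** * The Hahn-Banach theorem *)

Definition linear_of (K : numFieldType) (U V : lmodType K) (f : U -> V)
    (fL : linear f) : {linear U -> V} :=
  HB.pack f (GRing.isLinear.Build K U V *:%R f fL).

Section Sublinear.
Variables (R : realType) (V : lmodType R).
Implicit Types (q : V -> R) (x y : V).

Definition sublinear q :=
  (forall x y, q (x + y) <= q x + q y) /\
  (forall a x, 0 < a -> q (a *: x) <= a * q x).

Lemma sublinear0 q : sublinear q -> q 0 = 0.
Proof.
move=> [_ qZ]; have := qZ 2 0 (ltr0Sn _ _); have := qZ 2^-1 0.
by rewrite !scaler0 invr_gt0 => /(_ (ltr0Sn _ _)) h1 h2; lra.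
Qed.

Lemma sublinearZ q a x : sublinear q -> 0 <= a -> q (a *: x) = a * q x.
Proof.
move=> qS; rewrite le_eqVlt => /predU1P[<-|a0].
  by rewrite scale0r mul0r sublinear0.
apply/eqP; rewrite eq_le qS.2//= -ler_pdivlMl// -[in leLHS](scale1r x).
by rewrite -(mulVf (lt0r_neq0 a0)) -scalerA qS.2 ?invr_gt0.
Qed.

Lemma sublinearN q x : sublinear q -> - q (- x) <= q x.
Proof.
by move=> qS; have := qS.1 x (- x); rewrite subrr sublinear0// => ?; lra.
Qed.

(* A sublinear function minimal among those below q is equal to its slide in every
   direction, hence is linear; sliding q along y first makes it attain q y at y. *)
Definition slide q y x :=
  inf [set q (x + t *: y) - t * q y | t in [set t | 0 <= t]].

Lemma slide_le q y x t : sublinear q -> 0 <= t ->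
  slide q y x <= q (x + t *: y) - t * q y.
Proof.
move=> qS t0; apply: ge_inf; last by exists t.
(* The lower bound comes from [q (s *: y) <= q (x + s *: y) + q (- x)]. *)
exists (- q (- x)) => _ [s s0 <-]; rewrite -(sublinearZ _ qS)//.
have := qS.1 (x + s *: y) (- x); rewrite addrAC subrr add0r => ?; lra.
Qed.

Lemma le_slide q y x c :
  (forall t, 0 <= t -> c <= q (x + t *: y) - t * q y) -> c <= slide q y x.
Proof.
move=> h; apply: lb_le_inf => [|_ [t t0 <-]]; last exact: h.
by exists (q (x + 0 *: y) - 0 * q y), 0 => //=.
Qed.

Lemma slide_sublinear q y : sublinear q -> sublinear (slide q y).
Proof.
move=> qS; split=> [x z|a x a0].
  rewrite -lerBlDr; apply: le_slide => t t0.
  rewrite lerBlDr -lerBlDl; apply: le_slide => s s0.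
  (* Parameters [t] for [x] and [s] for [z] combine into the parameter [t + s] for [x + z]. *)
  have := slide_le y (x + z) qS (addr_ge0 t0 s0).
  have := qS.1 (x + t *: y) (z + s *: y).
  rewrite addrACA -scalerDl => *; lra.
rewrite -ler_pdivrMl//; apply: le_slide => t t0; rewrite ler_pdivrMl//.
have := slide_le y (a *: x) qS (mulr_ge0 (ltW a0) t0).
by rewrite -scalerA -scalerDr (sublinearZ _ qS (ltW a0))// mulrBr mulrA.
Qed.

Lemma slide_le_id q y x : sublinear q -> slide q y x <= q x.
Proof.
by move=> qS; have := slide_le y x qS (lexx 0); rewrite scale0r addr0 mul0r subr0.
Qed.

(** Zorn's lemma for the reversed pointwise order. A nonempty chain is bounded by its pointwise
    infimum, which is finite because each member is at least [- q (- x)] at [x]. *)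
Lemma minimal_sublinear q : sublinear q -> exists p,
  [/\ sublinear p, forall x, p x <= q x &
    forall r, sublinear r -> (forall x, r x <= p x) -> r = p].
Proof.
move=> qS; pose P := [set p | sublinear p /\ forall x, p x <= q x].
pose r (p1 p2 : {p | P p}) := `[< forall x, sval p2 x <= sval p1 x >].
have [||||[p [pS pq]] pmax] := @Zorn _ r.
- by move=> ?; apply/asboolP.
- move=> p1 p2 p3 /asboolP h1 /asboolP h2; apply/asboolP => x.
  exact: le_trans (h2 x) (h1 x).
- move=> [p1 ?] [p2 ?] /asboolP/= h1 /asboolP/= h2; apply/eq_exist/funext => x.
  by apply/eqP; rewrite eq_le h1 h2.
- move=> A Atot; have [[p0 Ap0]|/nonemptyPn A0] := pselect (A !=set0); last first.
    exists (exist _ q (conj qS (fun=> lexx _))) => s; rewrite A0 => -[].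
  pose m x := inf [set sval p x | p in A].
  have m_le p x : A p -> m x <= sval p x.
    move=> Ap; apply: ge_inf; last by exists p.
    exists (- q (- x)) => _ [[p' [p'S p'q]] _ <-] /=.
    by have := sublinearN x p'S; have := p'q (- x) => *; lra.
  have le_m c x : (forall p, A p -> c <= sval p x) -> c <= m x.
    move=> h; apply: lb_le_inf => [|_ [p Ap <-]]; last exact: h.
    by exists (sval p0 x), p0.
  suff mP : P m.
    exists (exist _ m mP) => s As; apply/asboolP => x /=; exact: m_le.
  split=> [|x]; last exact: le_trans (m_le _ x Ap0) ((svalP p0).2 x).
  split=> [x y|a x a0].
    rewrite -lerBlDr; apply: (le_m) => p1 Ap1.
    rewrite lerBlDr -lerBlDl; apply: le_m => p2 Ap2; rewrite lerBlDr.
    (* The smaller of the two members of the chain serves at both points. *)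
    have [/asboolP h|/asboolP h] := Atot _ _ Ap1 Ap2.
    + apply: le_trans (m_le _ _ Ap2) _; apply: le_trans ((svalP p2).1.1 _ _) _.
      by rewrite addrC lerD2l.
    + apply: le_trans (m_le _ _ Ap1) _; apply: le_trans ((svalP p1).1.1 _ _) _.
      by rewrite addrC lerD2r.
  rewrite -ler_pdivrMl//; apply: le_m => p Ap; rewrite ler_pdivrMl//.
  exact: le_trans (m_le _ _ Ap) ((svalP p).1.2 _ _ a0).
exists p; split=> // s sS sp.
have sq x : s x <= q x := le_trans (sp x) (pq x).
have := pmax (exist _ s (conj sS sq)).
by move=> /(_ (introT (asboolP _) sp)) /(congr1 sval).
Qed.

Lemma sublinear_support q : sublinear q -> forall y, exists f : {linear V -> R^o},
  (forall x, f x <= q x) /\ f y = q y.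
Proof.
move=> qS y; have sS := slide_sublinear y qS.
have [p [pS psl pmin]] := minimal_sublinear sS.
have pD x z : p (x + z) = p x + p z.
  apply/eqP; rewrite eq_le pS.1//=.
  (* Minimality makes [p] its own slide along [z]; the parameter 1 then gives
     [p x + p z <= p (x + z)]. *)
  have -> : p x = slide p z x.
    rewrite (pmin (slide p z))// => [|t]; last exact: slide_le_id.
    exact: slide_sublinear.
  have := slide_le z x pS ler01.
  by rewrite scale1r mul1r => ?; lra.
have pN x : p (- x) = - p x.
  by have := pD x (- x); rewrite subrr sublinear0// => ?; lra.
have pZ a x : p (a *: x) = a * p x.
  have [a0|a0] := leP 0 a; first exact: sublinearZ.
  apply: oppr_inj; rewrite -pN -scaleNr sublinearZ ?oppr_ge0 ?(ltW a0)//.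
  by rewrite mulNr.
have pq x : p x <= q x := le_trans (psl x) (slide_le_id y x qS).
have pL : linear (p : V -> R^o) by move=> a x z; rewrite pD pZ.
exists (linear_of pL); split=> //=; apply/eqP; rewrite eq_le pq/= -lerN2 -pN.
(* With parameter 1, the slide of [q] at [- y] is at most [q 0 - q y], so that
   [p (- y) <= - q y]. *)
apply: le_trans (psl _) _; apply: le_trans (slide_le y _ qS ler01) _.
by rewrite scale1r addNr sublinear0// mul1r sub0r.
Qed.

End Sublinear.

Definition seminorm (K : numFieldType) (V : lmodType K) (p : V -> K) :=
  (forall x y, p (x + y) <= p x + p y) /\ (forall a x, p (a *: x) = `|a| * p x).

(* Stated for a seminorm on a bare module because it is applied both to E and to
   dual E, which carries opnorm but no normed module structure. *)
Definition hahn_banach (K : numFieldType) :=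
  forall (V : lmodType K) (p : V -> K) (M : set V) (y : V) (d : K),
  seminorm p -> linear_subspace M -> 0 < d ->
  (forall m, M m -> d <= p (y - m)) ->
  exists f : {linear V -> K^o}, [/\ exists C : K, forall x, `|f x| <= C * p x,
    forall m, M m -> f m = 0 & f y != 0].

Lemma seminorm_ge0 (K : numFieldType) (V : lmodType K) (p : V -> K) x :
  seminorm p -> 0 <= p x.
Proof.
move=> [pD pZ]; have := pD x (- x).
rewrite subrr -scaleN1r pZ normrN1 mul1r -(scale0r 0) pZ normr0 mul0r.
by rewrite -mulr2n pmulrn_lge0.
Qed.

Lemma subspaceN (K : numFieldType) (V : lmodType K) (M : set V) x :
  linear_subspace M -> M x -> M (- x).
Proof. by move=> [M0 MD] Mx; have := MD (-1) x 0 Mx M0; rewrite addr0 scaleN1r. Qed.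

Lemma subspaceD (K : numFieldType) (V : lmodType K) (M : set V) x y :
  linear_subspace M -> M x -> M y -> M (x + y).
Proof. by move=> [M0 MD] Mx My; have := MD 1 x y Mx My; rewrite scale1r. Qed.

Lemma subspaceZ (K : numFieldType) (V : lmodType K) (M : set V) a x :
  linear_subspace M -> M x -> M (a *: x).
Proof. by move=> [M0 MD] Mx; have := MD a x 0 Mx M0; rewrite addr0. Qed.

(** The functional supports at [y] the distance [q] to [M] measured by [p]: [q y >= d] makes it
    nonzero at [y], [q <= 0] on the symmetric set [M] makes it vanish there, and [q <= p] bounds
    it. *)
Lemma hahn_banach_real (R : realType) : hahn_banach R.
Proof.
move=> V p M y d pS MS d0 dM.
pose q x := inf [set p (x - m) | m in M].
have q_le x m : M m -> q x <= p (x - m).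
  move=> Mm; apply: ge_inf; last by exists m.
  by exists 0 => _ [? _ <-]; exact: seminorm_ge0.
have le_q c x : (forall m, M m -> c <= p (x - m)) -> c <= q x.
  move=> h; apply: lb_le_inf => [|_ [m Mm <-]]; last exact: h.
  by exists (p (x - 0)), 0 => //; exact: MS.1.
have qp x : q x <= p x by have := q_le x 0 MS.1; rewrite subr0.
have qM m : M m -> q m <= 0.
  move=> Mm; apply: le_trans (q_le _ _ Mm) _.
  by rewrite subrr -(scale0r 0) pS.2 normr0 mul0r.
have qS : sublinear q.
  split=> [x z|a x a0].
    rewrite -lerBlDr; apply: (le_q) => m Mm.
    rewrite lerBlDr -lerBlDl; apply: le_q => n Mn; rewrite lerBlDr.
    apply: le_trans (q_le _ _ (subspaceD MS Mm Mn)) _.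
    by rewrite opprD addrACA addrC pS.1.
  rewrite -ler_pdivrMl//; apply: le_q => m Mm; rewrite ler_pdivrMl//.
  apply: le_trans (q_le _ _ (subspaceZ a MS Mm)) _.
  by rewrite -scalerBr pS.2 gtr0_norm.
have [f [fq fy]] := sublinear_support qS y.
exists f; split=> // [|m Mm|]; last first.
- by rewrite fy gt_eqF// (lt_le_trans d0)// le_q.
- apply/eqP; rewrite eq_le (le_trans (fq m) (qM m Mm))/= -oppr_le0 -(raddfN f).
  by rewrite (le_trans (fq _))// qM//; exact: subspaceN.
- exists 1 => x; rewrite mul1r ler_norml (le_trans (fq x) (qp x)) andbT.
  rewrite lerNl -(raddfN f) (le_trans (fq _))// (le_trans (qp _))//.
  by rewrite -scaleN1r pS.2 normrN1 mul1r.
Qed.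

(** * Complex Hahn-Banach theorem by restriction to real scalars *)

Section Complexes.
Local Open Scope complex_scope.

(** A renamed copy of [V], so that the module structure over the reals does not compete with the
    complex one. *)
Definition realify (R : realType) (V : lmodType R[i]) : Type := V.

Section Realify.
Variables (R : realType) (V : lmodType R[i]).
HB.instance Definition _ := GRing.Zmodule.on (realify V).

Definition realify_scale (a : R) (x : realify V) : realify V :=
  a%:C *: (x : V).

Fact realify_scaleA a b x :
  realify_scale a (realify_scale b x) = realify_scale (a * b) x.
Proof. by rewrite /realify_scale scalerA -rmorphM. Qed.

Fact realify_scale1 : left_id 1 realify_scale.
Proof. by move=> x; rewrite /realify_scale rmorph1 scale1r. Qed.

Fact realify_scaleDr : right_distributive realify_scale +%R.
Proof. by move=> a x y; exact: scalerDr. Qed.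

Fact realify_scaleDl x : {morph realify_scale^~ x : a b / a + b}.
Proof. by move=> a b; rewrite /realify_scale rmorphD; exact: scalerDl. Qed.

HB.instance Definition _ := GRing.Zmodule_isLmodule.Build R (realify V)
  realify_scaleA realify_scale1 realify_scaleDr realify_scaleDl.
End Realify.

Lemma hahn_banach_complex (R : realType) : hahn_banach R[i].
Proof.
move=> V p M y d pS MS d0 dM.
have pRe x : p x = (complex.Re (p x))%:C.
  by rewrite RRe_real// ger0_real// seminorm_ge0.
have normC a : `|a%:C| = `|a|%:C :> R[i].
  by rewrite normc_def /= expr0n addr0 sqrtr_sqr.
have [||||f [[C fC] fM fy]] := @hahn_banach_real R (realify V)
    (fun x => complex.Re (p x)) M y (complex.Re d).
- split=> [x z|a x].
    by have := pS.1 x z; rewrite lecE => /andP[_]; rewrite raddfD.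
  apply: complexI; transitivity (p (a%:C *: (x : V))); first exact/esym/pRe.
  by rewrite pS.2 normC [p x]pRe -rmorphM.
- by split=> [|a x z Mx Mz]; [exact: MS.1 | exact: MS.2].
- by move: d0; rewrite ltcE => /andP[].
- by move=> m /dM; rewrite lecE => /andP[].
pose h (x : V) : R := f x.
have hD (x z : V) : h (x + z) = h x + h z by exact: (raddfD f).
have hZ a (x : V) : h (a%:C *: x) = a * h x by exact: (linearZ_LR f a (x : realify V)).
(* The only complex-linear functional with real part [h]. *)
pose g (x : V) : R[i] := (h x)%:C - 'i * (h ('i *: x))%:C.
have gRe x : complex.Re (g x) = h x by rewrite /g /=; ring.
have gD x z : g (x + z) = g x + g z.
  by rewrite /g hD scalerDr hD !rmorphD; ring.
have gZr a x : g (a%:C *: x) = a%:C * g x.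
  have E : 'i *: (a%:C *: x) = a%:C *: ('i *: x) by rewrite !scalerA mulrC.
  by rewrite /g E !hZ !rmorphM /=; ring.
have gi x : g ('i *: x) = 'i * g x.
  have hN : h (- x) = - h x by exact: (raddfN f).
  rewrite /g scalerA -expr2 sqr_i scaleN1r hN rmorphN mulrBr mulrA -expr2.
  by rewrite sqr_i; ring.
have gL : linear (g : V -> R[i]^o).
  move=> a x z; rewrite gD; congr (_ + _); rewrite [a]complexE scalerDl gD.
  by rewrite -scalerA gi !gZr -[RHS]/(_ * _) mulrDl mulrA.
exists (linear_of gL); split=> /=.
(* One [C] for [h x] and one for [h ('i *: x)], since [p ('i *: x) = p x]. *)
- exists (`|C|%:C + `|C|%:C) => x; rewrite /g (le_trans (ler_normB _ _))// mulrDl.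
  have hp z : `|(h z)%:C| <= `|C|%:C * p z.
    rewrite normC [p z]pRe -rmorphM lecR (le_trans (fC z))// ler_wpM2r ?ler_norm//.
    by rewrite -ler0c -pRe seminorm_ge0.
  rewrite lerD// normrM.
  have i1 : `|'i| = 1 :> R[i] by rewrite normc_def /= expr0n expr1n add0r sqrtr1.
  by rewrite i1 mul1r (le_trans (hp _))// pS.2 i1 mul1r.
(* [M] is a complex subspace, so [h] also vanishes at ['i *: m]. *)
- by move=> m Mm; rewrite /g /h (fM m Mm) fM ?mulr0 ?subr0//; exact: subspaceZ.
- apply: contra_neq fy => g0; by rewrite -[LHS]/(h y) -gRe g0.
Qed.
End Complexes.

(** * Operator norm and pairing *)

Section Scalars.
Variable K : numFieldType.

(* With hahn_banach, the properties shared by R and R[i] on which the proof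
   relies. In R[i] only nonnegative sets can be expected to have suprema. *)
Definition nonneg_complete := forall A : set K, A !=set0 -> lbound A 0 ->
  ubound A !=set0 -> supremums A !=set0.

Definition cauchy_complete := forall u : nat -> K^o,
  (forall e : K, 0 < e -> exists N : nat, forall m n : nat,
    (N <= m)%N -> (N <= n)%N -> `|u m - u n| < e) -> cvgn u.

Definition archimedean := forall e : K, 0 < e -> exists n : nat, 2^-1 ^+ n < e.

Hypothesis Ksup : nonneg_complete.

(** [supremum] chooses a point of [supremums A] and falls back on the default 0, so its value is
    meaningful only once such a point is known to exist. *)
Lemma supremumP (A : set K) : A !=set0 -> lbound A 0 -> ubound A !=set0 ->
  supremums A (supremum 0 A).
Proof.
move=> A0 Age Aub; rewrite /supremum; case: eqP => [A_eq|_].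
  by move: A0; rewrite A_eq => -[].
by apply: xgetPex; exact: Ksup.
Qed.

(** The infimum is the supremum of the nonnegative lower bounds, a set to which [Ksup] applies. *)
Lemma infimumP (A : set K) : A !=set0 -> lbound A 0 -> infimums A (infimum 0 A).
Proof.
move=> [a0 Aa0] Age; pose L := [set l : K | 0 <= l /\ lbound A l].
have [s [sub slb]] : supremums L !=set0.
  apply: Ksup; [by exists 0|by move=> l []|].
  by exists a0 => l [_ /(_ _ Aa0)].
have s_inf : infimums A s.
  (* A lower bound is real because it lies below an element of [A]; a negative one is below [s]
     because 0 belongs to [L]. *)
  split=> [a Aa|l Al]; first by apply: slb => l [_ /(_ _ Aa)].
  have s0 : 0 <= s by exact: sub.
  have lr : l \is Num.real by rewrite (ler_real (Al _ Aa0)) ger0_real// Age.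
  have [l0|/ltW l0] := real_leP (real0 K) lr; first exact: sub.
  exact: le_trans s0.
rewrite /infimum; case: eqP => [A_eq|_]; first by move: Aa0; rewrite A_eq.
by apply: xgetPex; exists s.
Qed.

Lemma infimum_lt (A : set K) (e : K) : A !=set0 -> lbound A 0 ->
  infimum 0 A < e -> exists2 a, A a & a < e.
Proof.
move=> A0 Age inf_e; have [_ inf_ge] := infimumP A0 Age.
apply: contrapT => h.
have er : e \is Num.real by rewrite ger0_real// (le_trans _ (ltW inf_e))// inf_ge.
have /inf_ge : lbound A e.
  move=> a Aa; have [//|ae] := real_leP er (ger0_real (Age _ Aa)).
  by exfalso; apply: h; exists a.
by move=> /(lt_le_trans inf_e); rewrite ltxx.
Qed.

End Scalars.

Section OperatorNorm.
Variables (K : numFieldType) (E F : normedModType K).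
Hypothesis Ksup : nonneg_complete K.
Implicit Types T : bop E F.

Lemma bop_ge0_bounded T : exists2 M : K, 0 <= M & forall x, `|T x| <= M * `|x|.
Proof.
have [M TM] := bop_bounded T; exists `|M| => // x.
rewrite -[X in _ <= _ * X]normr_id -normrM ger0_norm//.
exact: le_trans (normr_ge0 _) (TM x).
Qed.

Lemma opnorm_sup T :
  supremums [set `|T x| | x in [set x : E | `|x| <= 1]] (opnorm T).
Proof.
apply: supremumP => //.
- by exists `|T 0|, 0; rewrite //= normr0.
- by move=> _ [x _ <-].
- have [M M0 TM] := bop_ge0_bounded T; exists M => _ [x /= x1 <-].
  by rewrite (le_trans (TM x))// ler_piMr.
Qed.

Lemma opnorm_le T (M : K) : 0 <= M -> (forall x, `|T x| <= M * `|x|) ->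
  opnorm T <= M.
Proof.
move=> M0 TM; apply: (opnorm_sup T).2 => _ [x /= x1 <-].
by rewrite (le_trans (TM x))// ler_piMr.
Qed.

Lemma opnorm_ge0 T : 0 <= opnorm T.
Proof.
apply: le_trans (normr_ge0 (T 0)) _; apply: (opnorm_sup T).1.
by exists 0; rewrite //= normr0.
Qed.

Lemma le_opnorm T x : `|T x| <= opnorm T * `|x|.
Proof.
have [->|x0] := eqVneq x 0; first by rewrite linear0 !normr0 mulr0.
have nx : 0 < `|x| by rewrite normr_gt0.
rewrite -ler_pdivrMr//; apply: (opnorm_sup T).1; exists (`|x|^-1 *: x).
  by rewrite /= normrZ normfV normr_id mulVf ?gt_eqF.
by rewrite linearZ normrZ normfV normr_id mulrC.
Qed.

Lemma opnorm_seminorm : seminorm (@opnorm K E F).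
Proof.
split=> [S T|a T].
  apply: opnorm_le => [|x]; first by rewrite addr_ge0 ?opnorm_ge0.
  by rewrite mulrDl (le_trans (ler_normD _ _))// lerD ?le_opnorm.
have leZ b (S : bop E F) : opnorm (b *: S) <= `|b| * opnorm S.
  apply: opnorm_le => [|x]; first by rewrite mulr_ge0 ?opnorm_ge0.
  by rewrite -[X in `|X|]/(b *: S x) normrZ -mulrA ler_wpM2l ?le_opnorm.
apply/eqP; rewrite eq_le leZ/=; have [->|a0] := eqVneq a 0.
  by rewrite normr0 mul0r opnorm_ge0.
rewrite -ler_pdivlMl ?normr_gt0// -normfV -[in leLHS](scale1r T) -(mulVf a0).
by rewrite -scalerA leZ.
Qed.

End OperatorNorm.

(** * Pairing of tensors with operators *)

Section Pairing.
Variables (K : numFieldType) (E : normedModType K).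
Hypotheses (Ksup : nonneg_complete K) (Kcauchy : cauchy_complete K).
Hypothesis (Karchi : archimedean K).
Implicit Types (T : 'B(E)) (v w : formal_sum E) (u : projective_tensor E).

Definition tensor_pairing T w : K := \sum_(p <- w) p.2 (T p.1).

(** The bilinear map against which [tensor_eq] is tested, so that the pairing depends only on the
    tensor. *)
Definition evaluation T (x : E) (l : dual E) : K^o := l (T x).

Lemma evaluation_bilinear T : bilinear_for *:%R *:%R (evaluation T).
Proof.
split=> [l a x y|x a l m]; rewrite /evaluation; first by rewrite !linearP.
by [].
Qed.

HB.instance Definition _ T := bilinear_isBilinear.Build K E (dual E) K^o
  *:%R *:%R (evaluation T) (evaluation_bilinear T).

Lemma tensor_pairing_eq T v w : tensor_eq v w ->
  tensor_pairing T v = tensor_pairing T w.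
Proof. by move=> /(_ _ (evaluation T)). Qed.

Lemma tensor_pairing_sub T v w :
  tensor_pairing T (tensor_sub v w) = tensor_pairing T v - tensor_pairing T w.
Proof.
rewrite /tensor_pairing big_cat big_map /= -sumrN; congr (_ + _).
by apply: eq_bigr => p _; rewrite !raddfN.
Qed.

Lemma tensor_pairing_le T v (M : K) : 0 <= M -> (forall x, `|T x| <= M * `|x|) ->
  `|tensor_pairing T v| <= M * \sum_(p <- v) `|p.1| * opnorm p.2.
Proof.
move=> M0 TM; rewrite mulr_sumr (le_trans (ler_norm_sum _ _ _))// ler_sum// => p _.
rewrite (le_trans (le_opnorm Ksup _ _))// mulrA mulrC ler_wpM2r ?opnorm_ge0//.
Qed.

Lemma projective_norm_inf w :
  infimums [set \sum_(p <- v) `|p.1| * opnorm p.2 | v in [set v | tensor_eq v w]]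
    (projective_norm w).
Proof.
apply: infimumP => //.
- by exists (\sum_(p <- w) `|p.1| * opnorm p.2), w => //= V b.
- by move=> _ [v _ <-]; rewrite sumr_ge0// => p _; rewrite mulr_ge0 ?opnorm_ge0.
Qed.

Lemma projective_norm_lt w (e : K) : projective_norm w < e -> exists2 v,
  tensor_eq v w & \sum_(p <- v) `|p.1| * opnorm p.2 < e.
Proof.
move=> /(infimum_lt Ksup)[||_ [v vw <-] ve]; last by exists v.
- by exists (\sum_(p <- w) `|p.1| * opnorm p.2), w => //= V b.
- by move=> _ [v _ <-]; rewrite sumr_ge0// => p _; rewrite mulr_ge0 ?opnorm_ge0.
Qed.

(** This gives content to the [lim] in [pairing]: pairing with [T] is bounded by a multiple of the
    projective norm, so it sends Cauchy sequences of tensors to Cauchy sequences of scalars. *)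
Lemma pairing_cvg u T : (tensor_pairing T (u n) : K^o) @[n --> \oo] --> pairing u T.
Proof.
have uC : projective_cauchy u by case: u.
suff : cvgn (fun n => tensor_pairing T (u n) : K^o) by [].
apply: Kcauchy => e e0; have [M M0 TM] := bop_ge0_bounded T.
have M1 : 0 < M + 1 by rewrite ltr_wpDl.
have [|N uN] := uC (e / (M + 1)); first by rewrite divr_gt0.
exists N => m n Nm Nn; have [v vw ve] := projective_norm_lt (uN m n Nm Nn).
rewrite -tensor_pairing_sub -(tensor_pairing_eq T vw).
rewrite (le_lt_trans (tensor_pairing_le v M0 TM))//.
rewrite -[e](divfK (lt0r_neq0 M1)) [in ltRHS]mulrC. 
rewrite (@le_lt_trans _ _ ((M+1) * \sum_(p <- v) `|p.1| * opnorm p.2)) ?ltr_pM2l//.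
rewrite ler_wpM2r// ?lerDl//.
by rewrite sumr_ge0// => p _; rewrite mulr_ge0 ?opnorm_ge0.
Qed.

End Pairing.

(** * Uniform convergence on compact sets *)

Section CompactPairing.
Variables (K : numFieldType) (E : normedModType K).

(** A filter on [C] that does not cluster at 0 contains the part of [C] outside some ball, which is
    finite and hence compact. *)
Lemma vanishing_compact (C : set E) : C 0 ->
  (forall e : K, 0 < e -> finite_set (C `\` [set x | `|x| < e])) -> compact C.
Proof.
move=> C0 Cfin F PF FC; have [?|] := pselect (cluster F (0 : E)); first by exists 0.
move=> /existsNP[A /existsNP[B /not_implyP[FA /not_implyP[B0 /nonemptyPn AB]]]].
have [e /= e0 eB] := (nbhs_norm0P (P := B)).1 B0.
have : F (C `\` [set x | `|x| < e]).
  apply: filterS (filterI FA FC) => x [Ax Cx]; split=> // xe.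
  by rewrite -[False]/(set0 x) -AB; split=> //; exact: eB.
move=> /(finite_compact (Cfin e e0))[x [[Cx _] Fx]]; by exists x.
Qed.

Hypotheses (Ksup : nonneg_complete K) (Kcauchy : cauchy_complete K).
Hypothesis (Karchi : archimedean K).
Implicit Types (T : 'B(E)) (u : projective_tensor E).

Local Notation r k := (2^-1 ^+ k : K).

Lemma sum_half k : \sum_(j < k) r j <= 2.
Proof.
have -> : \sum_(j < k) r j = 2 - 2 * r k.
  elim: k => [|k IH]; first by rewrite big_ord0 expr0 mulr1 subrr.
  by rewrite big_ord_recr /= IH exprS mulrA divff ?pnatr_eq0// mul1r; ring.
by rewrite gerBl mulr_ge0// exprn_ge0// invr_ge0.
Qed.

(* Along a subsequence u splits as a series of differences of projective norm less
   than 4^-k; the vectors of the k-th one are rescaled to norm at most 2^-k. *)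
Lemma pairing_compact_bound u : exists (C : set E) (c : K),
  [/\ compact C, 0 < c & forall T d, 0 < d ->
    (forall x, C x -> `|T x| <= d) -> `|pairing u T| <= c * d].
Proof.
have r0 k : 0 < r k by rewrite exprn_gt0// invr_gt0.
have uC : projective_cauchy u by case: u.
have /choice[N uN] k : exists N : nat, forall m n : nat, (N <= m)%N -> (N <= n)%N ->
    projective_norm (tensor_sub (u m) (u n)) < r k * r k.
  by apply: uC; rewrite mulr_gt0.
(* The sum puts [n k] above [N k]; the summand [k] makes [n] strictly increasing and gives
   [k <= n k]. *)
pose n k := (\sum_(j < k.+1) N j + k)%N.
have nS k : (n k < n k.+1)%N.
  by rewrite /n [in ltnRHS]big_ord_recr /= addnS ltnS leq_add2r leq_addr.
have Nn k : (N k <= n k)%N.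
  by rewrite /n big_ord_recr /= -addnA addnCA leq_addr.
have /choice[v vP] k : exists v, tensor_eq v (tensor_sub (u (n k.+1)) (u (n k))) /\
    \sum_(p <- v) `|p.1| * opnorm p.2 < r k * r k.
  have Nn1 := leq_trans (Nn k) (ltnW (nS k)).
  have [v ? ?] := projective_norm_lt Ksup (uN k (n k.+1) (n k) Nn1 (Nn k)).
  by exists v.
have uE T k : tensor_pairing T (u (n k)) =
    tensor_pairing T (u (n 0)) + \sum_(j < k) tensor_pairing T (v j).
  elim: k => [|k IH]; first by rewrite big_ord0 addr0.
  rewrite big_ord_recr /= addrA -IH (tensor_pairing_eq T (vP k).1).
  by rewrite tensor_pairing_sub addrC subrK.
(* A zero vector stays zero, division by 0 being 0. Rescaling uses up one factor [r k] of the bound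
   [r k * r k] and leaves the other to be summed. *)
pose s k (p : E * dual E) : E := (r k / `|p.1|) *: p.1.
pose C1 : set E := [set p.1 | p in [set` u (n 0)]].
pose C2 : set E := 0 |` \bigcup_k [set s k p | p in [set` v k]].
have s_le k p : `|s k p| <= r k.
  rewrite normrZ normrM normfV normr_id (gtr0_norm (r0 k)).
  have [->|p0] := eqVneq p.1 0; first by rewrite normr0 mulr0 ltW.
  by rewrite divfK// normr_eq0.
(* The sum bounds the initial term [u (n 0)], 2 the geometric series of differences, and 1 the
   distance from a partial sum to the limit. *)
exists (C1 `|` C2), (\sum_(p <- u (n 0)) opnorm p.2 + 2 + 1); split.
- apply: compactU; first by apply: finite_compact; exact/finite_image/finite_seq.
  apply: vanishing_compact; first by left.
  move=> e e0; have [k ke] := Karchi e0.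
  apply: (@sub_finite_set _ _ (\bigcup_(j in `I_k) [set s j p | p in [set` v j]])).
    move=> x [[->|[j _ [p pv <-]]] /= h]; first by rewrite normr0 in h.
    exists j; last by exists p.
    rewrite /= ltnNge; apply/negP => kj; apply: h.
    rewrite (le_lt_trans (s_le j p))// (le_lt_trans _ ke)//.
    by rewrite ler_wiXn2l// ?invr_ge0// invf_le1// ler1n.
  apply: bigcup_finite => [|j _]; first exact: finite_II.
  exact/finite_image/finite_seq.
- by rewrite ltr_wpDl// addr_ge0// sumr_ge0// => p _; exact: opnorm_ge0.
move=> T d d0 Td.
have T0 : `|tensor_pairing T (u (n 0))| <= (\sum_(p <- u (n 0)) opnorm p.2) * d.
  rewrite mulr_suml (le_trans (ler_norm_sum _ _ _))//.
  rewrite big_seq [leRHS]big_seq ler_sum// => p pu.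
  rewrite (le_trans (le_opnorm Ksup _ _))// ler_wpM2l ?opnorm_ge0//.
  by apply: Td; left; exists p.
have Tv k : `|tensor_pairing T (v k)| <= r k * d.
  rewrite (le_trans (ler_norm_sum _ _ _))//.
  (* [T p.1] is [T (s k p)] scaled by [|p.1| / r k], whence the factor [(r k)^-1]. *)
  apply: (@le_trans _ _ (\sum_(p <- v k) (`|p.1| * opnorm p.2) * ((r k)^-1 * d))).
    rewrite big_seq [leRHS]big_seq ler_sum// => p pv.
    rewrite (le_trans (le_opnorm Ksup _ _))// (mulrC `|p.1|) -!mulrA.
    rewrite ler_wpM2l ?opnorm_ge0//.
    have [->|p0] := eqVneq p.1 0; first by rewrite linear0 !normr0 mul0r.
    have np : 0 < `|p.1| by rewrite normr_gt0.
    have h : `|T (s k p)| <= d by apply: Td; right; right; exists k => //; exists p.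
    rewrite mulrA -ler_pdivrMl ?divr_gt0// invf_div; move: h.
    by rewrite linearZ normrZ normrM normfV normr_id gtr0_norm.
  rewrite -mulr_suml mulrA ler_wpM2r ?(ltW d0)// ler_pdivrMr//.
  by rewrite ltW// (vP k).2.
have Tu k : `|tensor_pairing T (u (n k))| <= (\sum_(p <- u (n 0)) opnorm p.2 + 2) * d.
  rewrite uE (le_trans (ler_normD _ _))// mulrDl lerD//.
  rewrite (le_trans (ler_norm_sum _ _ _))//.
  rewrite (@le_trans _ _ (\sum_(j < k) r j * d))// ?ler_sum//.
  by rewrite -mulr_suml ler_wpM2r ?sum_half// ltW.
have [k _ ud] := (cvgrPdist_lt _ _).1 (@pairing_cvg _ _ Ksup Kcauchy u T) d d0.
have kn : (k <= n k)%N by rewrite leq_addl.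
rewrite mulrDl mul1r -[pairing u T](subrK (tensor_pairing T (u (n k)))).
by rewrite (le_trans (ler_normD _ _))// addrC lerD// ltW// ud.
Qed.

Lemma pairingB u (S T : 'B(E)) : pairing u (S - T) = pairing u S - pairing u T.
Proof.
have cST := cvgB (@pairing_cvg _ _ Ksup Kcauchy u S)
  (@pairing_cvg _ _ Ksup Kcauchy u T).
rewrite -(cvg_lim (@norm_hausdorff _ K^o) (cST _)); congr (lim (_ @ \oo)).
apply/funext => n; rewrite /= -[RHS]/(_ - _) -sumrB.
by apply: eq_bigr => p _; exact: (linearB p.2 (S p.1) (T p.1)).
Qed.

(** The topology is induced by a map into a product, so convergence is tested in the product and
    there coordinate by coordinate. *)
Lemma weakstar_cvg (F : set_system 'B(E)) T : Filter F ->
  (forall u, pairing u S @[S --> F] --> pairing u T) -> F --> (T : weakstar E).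
Proof.
move=> FF FT A; rewrite nbhsE => -[_ [[B oB <-] BT]] /filterS; apply.
suff : (fun S : 'B(E) =>
      (fun u => pairing u S) : {ptws projective_tensor E -> K^o}) @ F -->
    ((fun u => pairing u T) : {ptws projective_tensor E -> K^o}).
  by apply; exact: open_nbhs_nbhs.
apply/cvg_sup => u D; rewrite nbhsE => -[_ [[D' oD' <-] D'T]] /filterS; apply.
by apply: (FT u); exact: open_nbhs_nbhs.
Qed.

(** The elements of [I] close to [T] on compact sets generate a proper filter, which converges weak*
    to [T] by [pairing_compact_bound]. *)
Lemma weakstar_closed_compact (I : set 'B(E)) T : weakstar_closed I ->
  (forall (C : set E) (e : K), compact C -> 0 < e ->
    exists2 S, I S & forall x, C x -> `|S x - T x| <= e) -> I T.
Proof.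
move=> Icl IT.
pose D := [set Ce : set E * K | compact Ce.1 /\ 0 < Ce.2].
pose B (Ce : set E * K) := [set S | I S /\ forall x, Ce.1 x -> `|S x - T x| <= Ce.2].
have FF : ProperFilter (filter_from D B).
  apply: filter_from_proper; last first.
    by move=> [C e] [cC e0]; have [S IS ST] := IT C e cC e0; exists S.
  apply: filter_from_filter; first by exists (set0, 1); split=> //; exact: compact0.
  move=> [C1 e1] [C2 e2] [/= c1 e10] [/= c2 e20].
  (* Positive scalars are real, hence comparable, so one of the two tolerances is the smaller. *)
  have [e [e0 m1 m2]] : exists e, [/\ 0 < e, e <= e1 & e <= e2].
    by have [h|/ltW h] := real_leP (gtr0_real e10) (gtr0_real e20);
      [exists e1 | exists e2].
  exists (C1 `|` C2, e); first by split=> //=; exact: compactU.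
  by move=> S [IS ST]; split; split=> //= x Cx;
    (rewrite (le_trans (ST x _))//=; by [left|right]).
apply: (Icl T) => /= A TA.
have : filter_from D B A.
  apply: (@weakstar_cvg (filter_from D B) T _ _ A TA) => u; apply/cvgrPdist_le => e e0.
  have [C [c [cC c0 uC]]] := pairing_compact_bound u.
  exists (C, e / c); first by split=> //=; rewrite divr_gt0.
  move=> S [IS ST] /=; rewrite distrC -pairingB -[e](divfK (lt0r_neq0 c0)) [leRHS]mulrC.
  by apply: uC => //; rewrite divr_gt0.
move=> [Ce DCe BA]; have [S BS] : B Ce !=set0.
  by case: Ce DCe {BA} => C e [cC e0]; have [S IS ST] := IT C e cC e0; exists S.
by exists S; split; [exact: BS.1 | exact: BA].
Qed.

End CompactPairing.

(** * Rank-one operators *)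

Lemma bopP (K : numFieldType) (E F : normedModType K) (S T : bop E F) :
  (forall x, S x = T x) -> S = T.
Proof. by move=> ST; exact/val_inj/funext. Qed.

Lemma bopB (K : numFieldType) (E F : normedModType K) (T : bop E F) x y :
  T (x - y) = T x - T y.
Proof. exact: linearB. Qed.

Lemma bopZ (K : numFieldType) (E F : normedModType K) (T : bop E F) a x :
  T (a *: x) = a *: T x.
Proof. exact: linearZ_LR. Qed.

Lemma bop_sum (K : numFieldType) (E F : normedModType K) (T : bop E F) n
    (v : 'I_n -> E) : T (\sum_i v i) = \sum_i T (v i).
Proof. exact: linear_sum. Qed.

Section RankOne.
Variables (K : numFieldType) (E : normedModType K).
Implicit Types (x y : E) (l m : dual E) (S T U : 'B(E)) (J : set 'B(E)).

Fact rank_one_subproof y l :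
  (fun x => l x *: y) \in @bounded_linear K E E.
Proof.
apply/asboolP; split=> [a x z|]; first by rewrite linearP scalerDl scalerA.
have [M lM] := bop_bounded l; exists (M * `|y|) => x.
by rewrite normrZ mulrAC ler_wpM2r.
Qed.

Definition rank_one y l : 'B(E) := Bop (rank_one_subproof y l).

Fact dual_comp_subproof l T : (l \o T : E -> K^o) \in @bounded_linear K E K^o.
Proof.
apply/asboolP; split=> [a x z|]; first by rewrite /= !linearP.
have [M lM] := bop_bounded l; have [N TN] := bop_bounded T.
exists (`|M| * N) => x; rewrite (le_trans (lM _))//.
have h : 0 <= M * `|T x| by exact: le_trans (normr_ge0 _) (lM _).
by rewrite -(ger0_norm h) normrM normr_id -mulrA ler_wpM2l.
Qed.

(** The adjoint of [T] applied to [l]. *)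
Definition dual_comp l T : dual E := Bop (dual_comp_subproof l T).

Lemma rank_onePl a y z l : rank_one (a *: y + z) l = a *: rank_one y l + rank_one z l.
Proof.
apply: bopP => x; rewrite -[RHS]/(a *: (l x *: y) + l x *: z).
by rewrite scalerA mulrC -scalerA -scalerDr.
Qed.

Lemma rank_onePr a y l m : rank_one y (a *: l + m) = a *: rank_one y l + rank_one y m.
Proof.
apply: bopP => x; rewrite -[RHS]/(a *: (l x *: y) + m x *: y).
by rewrite scalerA -scalerDl.
Qed.

Lemma rank_one_compl T y l : T * rank_one y l = rank_one (T y) l.
Proof. by apply: bopP => x; exact: linearZ. Qed.

Lemma rank_one_compr T y l : rank_one y l * T = rank_one y (dual_comp l T).
Proof. exact: bopP. Qed.

Lemma bop_continuous (F : normedModType K) (T : bop E F) : continuous T.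
Proof.
have [M TM] := bop_bounded T.
apply: (bounded_linear_continuous (f := T)); apply/linear_boundedP.
exists `|M|; split; first exact: normr_real.
move=> r Mr x; rewrite (le_trans (TM x))// (@le_trans _ _ (`|M| * `|x|))//.
  have h : 0 <= M * `|x| by exact: le_trans (normr_ge0 _) (TM x).
  by rewrite -(ger0_norm h) normrM normr_id.
by rewrite ler_wpM2r// ltW.
Qed.

(** Compactness in near-covering form, with the filter at infinity: on the unit ball around [x],
    every [r >= |x| + 1] bounds the norm. *)
Lemma compact_norm_bound (C : set E) : compact C ->
  exists2 M : K, 0 < M & forall x, C x -> `|x| <= M.
Proof.
move=> /compact_near_coveringP cC.
have [|M [Mr MC]] := cC _ +oo_K (fun r x => `|x| <= r) _.
  move=> x _; exists ([set z | `|z| < `|x| + 1], [set r | `|x| + 1 <= r]).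
    split=> /=; last by apply: nbhs_pinfty_ge; rewrite ger0_real// addr_ge0.
    apply/nbhs_normP; exists 1 => //= z /= xz; rewrite -[z](subrK x).
    by rewrite (le_lt_trans (ler_normD _ _))// addrC ltrD2l distrC.
  by move=> [z r] [/= zx xr]; rewrite (le_trans (ltW zx)).
exists (`|M| + 1); first by rewrite ltr_wpDl.
by apply: MC; rewrite (le_lt_trans (real_ler_norm Mr))// ltrDl.
Qed.

Lemma weakstar_eval x l : nonneg_complete K -> exists u : projective_tensor E,
  forall T, pairing u T = l (T x).
Proof.
move=> Ksup; pose w : formal_sum E := [:: (x, l)].
have wC : @projective_cauchy K E (fun=> w).
  move=> e e0; exists 0%N => _ _ _ _; rewrite (le_lt_trans _ e0)//.
  (* The empty formal sum also represents [w - w], so its projective norm is at most 0. *)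
  apply: (projective_norm_inf Ksup (tensor_sub w w)).1; exists [::];
    last by rewrite big_nil.
  by move=> V b; rewrite big_nil !big_cons big_nil /= addr0 linearNl subrr.
exists (ProjectiveTensor wC) => T.
have uE : (\sum_(p <- w) p.2 (T p.1) : K^o) @[n --> \oo] --> (l (T x) : K^o).
  by rewrite big_cons big_nil addr0; exact: cvg_cst.
exact: (cvg_lim (@norm_hausdorff _ K^o) uE).
Qed.

Lemma weakstar_continuous (u : projective_tensor E) :
  continuous (fun T : weakstar E => pairing u T).
Proof.
move=> T; have := @initial_continuous _ _ (fun T : 'B(E) =>
    ((fun u => pairing u T) : {ptws projective_tensor E -> K^o})) T.
move=> h; apply: (@continuous_comp (weakstar E) {ptws projective_tensor E -> K^o} K^o
  (fun S u => pairing u S) (fun f => f u)) => //.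
exact: (@proj_continuous _ (fun=> K^o) u).
Qed.

Lemma closed_eval x l : nonneg_complete K ->
  weakstar_closed [set T : 'B(E) | l (T x) = 0].
Proof.
move=> Ksup; have [u uE] := weakstar_eval x l Ksup.
have -> : [set T : 'B(E) | l (T x) = 0] =
    (fun T : weakstar E => pairing u T) @^-1` [set 0].
  by apply/seteqP; split=> T /=; rewrite uE.
apply: preimage_closed; first by move=> ? _; exact: weakstar_continuous.
exact/accessible_closed_set1/hausdorff_accessible/norm_hausdorff.
Qed.

End RankOne.

(** * Ideals *)

Section Ideals.
Variables (K : numFieldType) (E : normedModType K).
Hypotheses (Ksup : nonneg_complete K) (Kcauchy : cauchy_complete K).
Hypotheses (Karchi : archimedean K) (KHB : hahn_banach K).
Implicit Types (x y : E) (l m : dual E) (S T U : 'B(E)) (I J : set 'B(E)).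

Lemma dual_separation (F : set E) y : closed_subspace F -> ~ F y ->
  exists l : dual E, (forall x, F x -> l x = 0) /\ l y != 0.
Proof.
move=> [FS Fcl] Fy.
have : nbhs y (~` F) by apply: open_nbhs_nbhs; split=> //; exact: closed_openC.
move=> /nbhs_normP[d /= d0 dF].
have [||f [fb fF fy]] := KHB (p := fun x : E => `|x|) (y := y) (d := d) _ FS d0.
- by split=> [x z|a x]; [exact: ler_normD | exact: normrZ].
- move=> x Fx; have [//|yx] := real_leP (gtr0_real d0) (normr_real (y - x)).
  by exfalso; exact: (dF x).
have fB : (f : E -> K^o) \in @bounded_linear K E K^o.
  by apply/asboolP; split=> //; exact: linearP.
by exists (Bop fB).
Qed.

Lemma dual_separates y : (forall l : dual E, l y = 0) -> y = 0.
Proof.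
move=> ly; apply: contrapT => y0.
have [||l [_]] := @dual_separation [set 0] y; last by rewrite ly eqxx.
  split; first by split=> // a x z /= -> ->; rewrite scaler0 addr0.
  exact/accessible_closed_set1/hausdorff_accessible/norm_hausdorff.
by [].
Qed.

(* Subtracting rank_one (U z) (dual_comp l U) with l (U z) = 1 replaces U by an
   operator with range in the kernel of l, hence spanned by one vector less. *)
Lemma finite_rank_decomposition J U : linear_subspace J -> finite_rank U ->
  (forall x l, J (rank_one (U x) (dual_comp l U))) -> J U.
Proof.
move=> JS [n [v Uv]]; elim: n => [|n IH] in U v Uv *.
  move=> _; suff -> : U = 0 by exact: JS.1.
  by apply: bopP => x; have [c ->] := Uv x; rewrite big_ord0.
move=> JU; have [U0|/existsNP[z Uz]] := pselect (forall x, U x = 0).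
  by have -> : U = 0; [exact: bopP | exact: JS.1].
have /existsNP[l0 /eqP l0z] : ~ forall l : dual E, l (U z) = 0.
  by move=> h; apply: Uz; exact: dual_separates.
have [l lz] : exists l : dual E, l (U z) = 1.
  by exists ((l0 (U z))^-1 *: l0); rewrite -[LHS]/(_ * _) mulVf.
pose U' := U - rank_one (U z) (dual_comp l U).
have U'E x : U' x = U (x - l (U x) *: z) by rewrite bopB bopZ.
have lU' x : l (U' x) = 0.
  by rewrite -[U' x]/(U x - l (U x) *: U z) bopB bopZ lz -[_ *: 1]/(_ * 1) mulr1 subrr.
(* Otherwise [l] would vanish at [U z], a combination of the [v i]. This [v j] is the vector to
   discard. *)
have [j lj] : exists j, l (v j) != 0.
  apply: contrapT => h; have [c cE] := Uv z.
  have : l (U z) = 0.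
    rewrite cE bop_sum big1// => i _; rewrite bopZ.
    have [->|li] := eqVneq (l (v i)) 0; first by rewrite scaler0.
    by exfalso; apply: h; exists i.
  by rewrite lz => /eqP; rewrite oner_eq0.
have -> : U = U' + rank_one (U z) (dual_comp l U) by rewrite subrK.
apply: subspaceD => //.
(* The remaining vectors are projected along [v j] into the kernel of [l]. *)
pose v' (i : 'I_n) := v (lift j i) - (l (v (lift j i)) / l (v j)) *: v j.
apply: (IH U' v') => [x|x l'].
  have [c cE] : exists c : 'I_n.+1 -> K, U' x = \sum_(i < n.+1) c i *: v i.
    by rewrite U'E.
  exists (fun i => c (lift j i)).
  (* The corrections add up to a multiple of [l (U' x) = 0], and the term of index [j] is zero. *)
  have : \sum_(i < n.+1) c i *: (v i - (l (v i) / l (v j)) *: v j) = U' x.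
    under eq_bigr do rewrite scalerBr; rewrite sumrB -cE.
    under eq_bigr do rewrite scalerA mulrA; rewrite -scaler_suml -mulr_suml.
    have -> : \sum_(i < n.+1) c i * l (v i) = l (U' x).
      by rewrite cE bop_sum; apply: eq_bigr => i _; rewrite bopZ.
    by rewrite lU' mul0r scale0r subr0.
  by move=> <-; rewrite (bigD1_ord j)//= divff// scale1r subrr scaler0 add0r.
(* The hypothesis on [U] passes to [U']: its values are values of [U], and its adjoint takes values
   in the range of the adjoint of [U]. *)
rewrite U'E; have -> : dual_comp l' U' = dual_comp (l' - l' (U z) *: l) U.
  apply: bopP => t; rewrite -[LHS]/(l' (U t - l (U t) *: U z)) bopB bopZ.
  by rewrite -[RHS]/(l' (U t) - l' (U z) * l (U t)) -[_ *: _]/(_ * _) mulrC.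
exact: JU.
Qed.

Lemma ideal_ker_left_ideal (F : set E) : left_ideal (ideal_ker F).
Proof.
split; first split=> [x _ //|a S T SF TF x Fx].
  change (a *: S x + T x = 0).
  by rewrite (SF x Fx) (TF x Fx) scaler0 addr0.
by move=> S T TF x Fx; change (S (T x) = 0); rewrite (TF x Fx) linear0.
Qed.

Lemma ideal_im_right_ideal (F : set E) : linear_subspace F -> right_ideal (ideal_im F).
Proof.
move=> FS; split; first split=> [_ [x _ <-]|a S T SF TF _ [x _ <-]].
- exact: FS.1.
- by apply: FS.2; [apply: SF; exists x | apply: TF; exists x].
- by move=> S T TF _ [x _ <-]; apply: TF; exists (S x).
Qed.

Lemma weakstar_closed_ker (F : set E) : weakstar_closed (ideal_ker F).
Proof.
have -> : ideal_ker F =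
    \bigcap_(xl in [set xl : E * dual E | F xl.1]) [set T : 'B(E) | xl.2 (T xl.1) = 0].
  apply/seteqP; split=> [T TF [x l] /= Fx|T TF x Fx].
    by rewrite (TF x Fx) linear0.
  by apply: dual_separates => l; exact: (TF (x, l) Fx).
by apply: closed_bigI => -[x l] _; exact: closed_eval.
Qed.

(** By Hahn-Banach, [F] is the common kernel of the functionals vanishing on it, so membership
    reduces to the closed conditions of [closed_eval]. *)
Lemma weakstar_closed_im (F : set E) : closed_subspace F ->
  weakstar_closed (ideal_im F).
Proof.
move=> FS; have -> : ideal_im F =
    \bigcap_(xl in [set xl : E * dual E | forall y, F y -> xl.2 y = 0])
      [set T : 'B(E) | xl.2 (T xl.1) = 0].
  apply/seteqP; split=> [T TF [x l] /= lF|T TF _ [x _ <-]].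
    by apply: lF; apply: TF; exists x.
  apply: contrapT => /(dual_separation FS)[l [lF /eqP]]; apply.
  exact: (TF (x, l) lF).
by apply: closed_bigI => -[x l] _; exact: closed_eval.
Qed.

(** * Closed ideals under the approximation property *)

Section AP.
Hypothesis EAP : approximation_property E.

(** The approximation property is applied to the image of [C] under [T], compact by continuity. *)
Lemma approx_compl T (C : set E) (e : K) : compact C -> 0 < e ->
  exists2 S, finite_rank S & forall x, C x -> `|(S * T) x - T x| <= e.
Proof.
move=> cC e0; have [|S [Sfin SC]] := EAP (C := T @` C) _ e0.
  by apply: continuous_compact => //; apply: continuous_subspaceT; exact: bop_continuous.
by exists S => // x Cx; apply: ltW; apply: SC; exists x.
Qed.

Lemma approx_compr T (C : set E) (e : K) : compact C -> 0 < e ->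
  exists2 S, finite_rank S & forall x, C x -> `|(T * S) x - T x| <= e.
Proof.
move=> cC e0; have [M M0 TM] := bop_ge0_bounded T.
have M1 : 0 < M + 1 by rewrite ltr_wpDl.
have [|S [Sfin SC]] := EAP (C := C) (e := e / (M + 1)) cC.
  by rewrite divr_gt0.
exists S => // x Cx; rewrite -[(T * S) x]/(T (S x)) -bopB (le_trans (TM _))//.
rewrite -[e](divfK (lt0r_neq0 M1)) [leRHS]mulrC ler_pM// ?lerDl//.
by rewrite ltW// SC.
Qed.

Lemma right_ideal_im I : right_ideal I -> weakstar_closed I ->
  exists F : set E, closed_subspace F /\ I = ideal_im F.
Proof.
move=> [IS IM] Icl; exists [set y | forall l, I (rank_one y l)].
set F := [set y | _].
have FS : linear_subspace F.
  split=> [l|a y z Fy Fz l]; last by rewrite rank_onePl; exact: IS.2.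
  suff -> : rank_one 0 l = 0 by exact: IS.1.
  by apply: bopP => x; exact: scaler0.
split; first split=> //.
  move=> y Fy l; apply: (weakstar_closed_compact Ksup Kcauchy Karchi Icl) => C e cC e0.
  have [B B0 CB] := compact_norm_bound cC.
  (* Replacing [y] by [z] changes [rank_one y l] on [C] by at most [opnorm l * B] times the
     distance; adding 1 keeps the divisor positive. *)
  have d0 : 0 < e / ((opnorm l + 1) * B).
    by rewrite divr_gt0// mulr_gt0// ltr_wpDl// opnorm_ge0.
  have [z [Fz yz]] := Fy _ (nbhsx_ballx y _ d0).
  exists (rank_one z l) => // x Cx; rewrite -scalerBr normrZ distrC.
  have l1 : 0 < opnorm l + 1 by rewrite ltr_wpDl// opnorm_ge0.
  have lx : `|l x| <= (opnorm l + 1) * B.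
    rewrite (le_trans (le_opnorm Ksup l x))// ler_pM ?opnorm_ge0 ?lerDl//.
    exact: CB.
  have zy : `|y - z| <= e / ((opnorm l + 1) * B).
    by apply: ltW; move: yz; rewrite -ball_normE.
  rewrite (le_trans (ler_pM _ _ lx zy))// mulrC divfK//.
  by rewrite lt0r_neq0// mulr_gt0.
apply/seteqP; split=> [T IT _ [x _ <-] l|T TF].
  by rewrite -rank_one_compl; exact: IM.
apply: (weakstar_closed_compact Ksup Kcauchy Karchi Icl) => C e cC e0.
have [S Sfin ST] := approx_compr T cC e0; exists (T * S) => //.
apply: finite_rank_decomposition => //.
  have [n [v Sv]] := Sfin; exists n, (T \o v) => x; have [c cE] := Sv x; exists c.
  rewrite -[LHS]/(T (S x)) cE bop_sum; apply: eq_bigr => i _; exact: bopZ.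
by move=> x l; apply: TF; exists (S x).
Qed.

Hypothesis Erefl : reflexive_space E.

Lemma left_ideal_ker I : left_ideal I -> weakstar_closed I ->
  exists F : set E, closed_subspace F /\ I = ideal_ker F.
Proof.
move=> [IS IM] Icl; pose F := [set x | forall T, I T -> T x = 0].
exists F; split.
  split; first split=> [T _|a x y Fx Fy T IT]; first exact: linear0.
    have -> : T (a *: x + y) = a *: T x + T y by exact: linearP.
    by rewrite (Fx T IT) (Fy T IT) scaler0 addr0.
  have -> : F = \bigcap_(T in I) (T @^-1` [set 0]) by [].
  apply: closed_bigI => T _; apply: preimage_closed.
    by move=> ? _; exact: bop_continuous.
  exact/accessible_closed_set1/hausdorff_accessible/norm_hausdorff.
apply/seteqP; split=> [T IT x Fx|T TF]; first exact: Fx.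
pose M := [set m : dual E | forall y, I (rank_one y m)].
have MS : linear_subspace M.
  split=> [y|a l m Ml Mm y]; last by rewrite rank_onePr; exact: IS.2.
  suff -> : rank_one y 0 = 0 by exact: IS.1.
  by apply: bopP => x; exact: scale0r.
have MF m : (forall x, F x -> m x = 0) -> M m.
  move=> mF; apply: contrapT => Mm.
  have [d d0 dM] : exists2 d : K, 0 < d & forall l, M l -> d <= opnorm (m - l).
    (* If [m] were at distance 0 from [M], each [rank_one y m] would be a limit, uniform on compact
       sets, of operators [rank_one y l] in [I]. *)
    apply: contrapT => h; apply: Mm => y.
    apply: (weakstar_closed_compact Ksup Kcauchy Karchi Icl) => C e cC e0.
    have [B B0 CB] := compact_norm_bound cC.
    have y1 : 0 < `|y| + 1 by rewrite ltr_wpDl.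
    have d0 : 0 < e / ((`|y| + 1) * B) by rewrite divr_gt0// mulr_gt0.
    have [l Ml lm] : exists2 l, M l & opnorm (m - l) < e / ((`|y| + 1) * B).
      apply: contrapT => h'; apply: h; exists (e / ((`|y| + 1) * B)) => // l Ml.
      have [//|lm] := real_leP (gtr0_real d0) (ger0_real (opnorm_ge0 Ksup (m - l))).
      by exfalso; apply: h'; exists l.
    exists (rank_one y l) => // x Cx; rewrite -scalerBl normrZ distrC.
    have mx : `|m x - l x| <= e / ((`|y| + 1) * B) * B.
      rewrite -[m x - l x]/((m - l) x) (le_trans (le_opnorm Ksup (m - l) x))//.
      by rewrite ler_pM ?opnorm_ge0 ?(ltW lm)// CB.
    have yy : `|y| <= `|y| + 1 by rewrite lerDl.
    rewrite (le_trans (ler_pM _ _ mx yy))// -(mulrA _ B) (mulrC B) divfK//.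
    by rewrite lt0r_neq0// mulr_gt0.
  (* The separating functional lives on the dual; reflexivity turns it into a point [x], and it
     remains to see that [x] is in [F]. *)
  have [f [fb fM fm]] := KHB (@opnorm_seminorm _ E K^o Ksup) MS d0 dM.
  have [x xE] := Erefl (linearP f) fb.
  move/eqP: fm; apply; rewrite xE; apply: mF => S IS'.
  (* For [S] in [I], the functional [dual_comp l S] is in [M] by the left ideal property, so [f]
     kills it and [l (S x) = 0]. *)
  apply: dual_separates => l; have := fM (dual_comp l S); rewrite xE; apply.
  by move=> y; rewrite -rank_one_compr; exact: IM.
apply: (weakstar_closed_compact Ksup Kcauchy Karchi Icl) => C e cC e0.
have [S [n [v Sv]] ST] := approx_compl T cC e0; exists (S * T) => //.
apply: finite_rank_decomposition => // [|x l].
  by exists n, v => x; exact: Sv.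
(* [T] vanishes on [F], hence so does the adjoint image of [l] under [S * T]. *)
apply: MF => y Fy; rewrite -[LHS]/(l (S (T y))).
by rewrite (TF y Fy) !linear0.
Qed.

End AP.

Lemma weakstar_closed_ideals : reflexive_space E -> approximation_property E ->
  (forall I : set 'B(E), (left_ideal I /\ weakstar_closed I) <->
     exists F : set E, closed_subspace F /\ I = ideal_ker F) /\
  (forall I : set 'B(E), (right_ideal I /\ weakstar_closed I) <->
     exists F : set E, closed_subspace F /\ I = ideal_im F).
Proof.
move=> Erefl EAP; split=> I; split=> [[II Icl]|[F [FS ->]]].
- exact: left_ideal_ker.
- by split; [exact: ideal_ker_left_ideal | exact: weakstar_closed_ker].
- exact: right_ideal_im.
- by split; [exact: ideal_im_right_ideal FS.1 | exact: weakstar_closed_im].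
Qed.

End Ideals.

(** * Real and complex scalars *)

Section RealScalars.
Variable R : realType.

Lemma real_nonneg_complete : nonneg_complete R.
Proof.
move=> A A0 _ Aub; exists (sup A); split=> [x Ax|y Ay].
  exact: ub_le_sup.
exact: ge_sup.
Qed.

Lemma cauchy_seq_cvg (V : completeNormedModType R) (u : nat -> V) :
  (forall e : R, 0 < e -> exists N : nat, forall m n : nat,
    (N <= m)%N -> (N <= n)%N -> `|u m - u n| < e) -> cvgn u.
Proof.
move=> uC; apply/cauchy_cvgP; apply/cauchyP => e e0.
have [N uN] := uC e e0; exists (u N); exists N => // n /= Nn.
by rewrite -ball_normE /=; exact: uN.
Qed.

Lemma real_cauchy_complete : cauchy_complete R.
Proof. by move=> u; exact: (@cauchy_seq_cvg R^o). Qed.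

Lemma real_archimedean : archimedean R.
Proof.
move=> e e0; have h : `|2^-1 : R| < 1.
  by rewrite ger0_norm ?invr_ge0// invf_lt1// ltr1n.
have [n _ /(_ n (leqnn n))] := (cvgrPdist_lt _ _).1 (cvg_expr h) e e0.
by rewrite /= sub0r normrN ger0_norm ?exprn_ge0 ?invr_ge0//; exists n.
Qed.

End RealScalars.

Section ComplexScalars.
Variable R : realType.
Local Open Scope complex_scope.

Lemma nonneg_complexP (z : R[i]) : 0 <= z -> z = (complex.Re z)%:C.
Proof. by move=> z0; rewrite RRe_real// ger0_real. Qed.

(** Nonnegative complex numbers are real, and an upper bound of a nonempty set of them is again
    nonnegative, so the supremum of the real parts serves. *)
Lemma complex_nonneg_complete : nonneg_complete R[i].
Proof.
move=> A [a Aa] Age [M AM]; pose B := [set complex.Re z | z in A].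
have AE z : A z -> z = (complex.Re z)%:C by move=> /Age/nonneg_complexP.
have M0 : 0 <= M := le_trans (Age _ Aa) (AM _ Aa).
have [|||s [sub slb]] := @real_nonneg_complete R B.
- by exists (complex.Re a), a.
- by move=> _ [z /Age z0 <-]; move: z0; rewrite lecE => /andP[].
- by exists (complex.Re M) => _ [z /AM zM <-]; move: zM; rewrite lecE => /andP[].
exists s%:C; split=> [z Az|N AN].
  by rewrite (AE z Az) lecR; apply: sub; exists z.
have N0 : 0 <= N := le_trans (Age _ Aa) (AN _ Aa).
rewrite (nonneg_complexP N0) lecR; apply: slb => _ [z /AN zN <-].
by move: zN; rewrite lecE => /andP[].
Qed.

Lemma complex_archimedean : archimedean R[i].
Proof.
move=> e e0; have [|n ne] := @real_archimedean R (complex.Re e).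
  by move: e0; rewrite ltcE => /andP[].
exists n; rewrite (nonneg_complexP (ltW e0)).
by move: ne; rewrite -ltcR rmorphXn fmorphV rmorph_nat.
Qed.

Lemma normc_ge_Im (z : R[i]) : `|complex.Im z|%:C <= `|z|.
Proof.
have := normc_ge_Re (z * 'i); rewrite ReiNIm normrN normrM.
have -> : `|'i| = 1 :> R[i] by rewrite normc_def /= expr0n expr1n add0r sqrtr1.
by rewrite mulr1.
Qed.

Lemma complex_cauchy_complete : cauchy_complete R[i].
Proof.
move=> u uC; pose x n : R^o := complex.Re (u n); pose y n : R^o := complex.Im (u n).
have ReB (a b : R[i]) : complex.Re (a - b) = complex.Re a - complex.Re b.
  by rewrite raddfB.
have ImB (a b : R[i]) : complex.Im (a - b) = complex.Im a - complex.Im b.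
  by rewrite raddfB.
have xC : cvgn x.
  apply: real_cauchy_complete => e e0; have [|N uN] := uC e%:C; first by rewrite ltcR.
  exists N => m n Nm Nn; rewrite -ltcR /x -ReB.
  exact: le_lt_trans (normc_ge_Re _) (uN _ _ Nm Nn).
have yC : cvgn y.
  apply: real_cauchy_complete => e e0; have [|N uN] := uC e%:C; first by rewrite ltcR.
  exists N => m n Nm Nn; rewrite -ltcR /y -ImB.
  exact: le_lt_trans (normc_ge_Im _) (uN _ _ Nm Nn).
apply/cvg_ex; exists ((limn x)%:C + 'i * (limn y)%:C : R[i]^o).
(* A positive [e] is real, and each of the two coordinates may contribute half of it. *)
apply/cvgrPdist_lt => e e0; pose e2 := complex.Re e / 2.
have e20 : 0 < e2 by rewrite divr_gt0//; move: e0; rewrite ltcE => /andP[].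
have xe := (cvgrPdist_lt _ _).1 xC e2 e20; have ye := (cvgrPdist_lt _ _).1 yC e2 e20.
near=> n.
have xn : `|limn x - x n| < e2 by near: n; exact: xe.
have yn : `|limn y - y n| < e2 by near: n; exact: ye.
have normC a : `|a%:C| = `|a|%:C :> R[i].
  by rewrite normc_def /= expr0n addr0 sqrtr_sqr.
have i1 : `|'i| = 1 :> R[i] by rewrite normc_def /= expr0n expr1n add0r sqrtr1.
rewrite [u n]complexE opprD addrACA -mulrBr -!rmorphB.
rewrite (le_lt_trans (ler_normD _ _))// normrM i1 mul1r !normC -rmorphD.
rewrite (nonneg_complexP (ltW e0)) ltcR (splitr (complex.Re e)) ltrD//.
Unshelve. all: by end_near. Qed.

End ComplexScalars.

Local Open Scope complex_scope.

Theorem theorem6p3 (R : realType) :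
  (forall E : completeNormedModType R,
    reflexive_space E -> approximation_property E ->
    (forall I : set 'B(E), (left_ideal I /\ weakstar_closed I) <->
       exists F : set E, closed_subspace F /\ I = ideal_ker F) /\
    (forall I : set 'B(E), (right_ideal I /\ weakstar_closed I) <->
       exists F : set E, closed_subspace F /\ I = ideal_im F)) /\
  (forall E : completeNormedModType R[i],
    reflexive_space E -> approximation_property E ->
    (forall I : set 'B(E), (left_ideal I /\ weakstar_closed I) <->
       exists F : set E, closed_subspace F /\ I = ideal_ker F) /\
    (forall I : set 'B(E), (right_ideal I /\ weakstar_closed I) <->
       exists F : set E, closed_subspace F /\ I = ideal_im F)).
Proof.
split=> E; apply: weakstar_closed_ideals.
- exact: real_nonneg_complete.
- exact: real_cauchy_complete.
- exact: real_archimedean.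
- exact: hahn_banach_real.
- exact: complex_nonneg_complete.
- exact: complex_cauchy_complete.
- exact: complex_archimedean.
- exact: hahn_banach_complex.
Qed.
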